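(* Let $N$ be a positive integer and $a\in\{1,2,\ldots,N\}$. For formal variables $u,v$, $$\sum_{k\geq n+1,\ n\geq 1}t^\star_{N,a}(k-n+1,\{1\}^{n-1})\,u^{k-n-1}v^{n-1}=\frac{1}{(a-u)(a-v)}\;{}_3F_2\!\left(\begin{matrix}\frac{a}{N},\ \frac{a-u}{N},\ 1\\ \frac{a+N-u}{N},\ \frac{a+N-v}{N}\end{matrix};1\right).$$
   Context: $\{1\}^{n-1}$ denotes $1$ repeated $n-1$ times. For positive integers $k_1,\ldots,k_n$ with $k_1>1$, $$t^\star_{N,a}(k_1,\ldots,k_n)=\sum_{m_1\geq\cdots\geq m_n>0,\ m_i\equiv a\ (\mathrm{mod}\ N)}\frac{1}{m_1^{k_1}\cdots m_n^{k_n}}.$$ The generalized hypergeometric function is $${}_3F_2\!\left(\begin{matrix}b_1,b_2,b_3\\ c_1,c_2\end{matrix};z\right)=\sum_{j=0}^\infty\frac{(b_1)_j(b_2)_j(b_3)_j}{(c_1)_j(c_2)_j}\frac{z^j}{j!},$$ with $(b)_0=1$, $(b)_j=b(b+1)\cdots(b+j-1)$. The identity is one of formal power series in $u,v$: each term of the hypergeometric series is expanded as a power series in $u,v$ and the series is summed coefficientwise. *)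

(* Defs.v *)
From HB Require Import structures.
From mathcomp Require Import all_boot all_order all_algebra.
From mathcomp Require Import boolp classical_sets functions reals ereal.
From mathcomp Require Import topology normedtype sequences esum.

Set Implicit Arguments.
Unset Strict Implicit.
Unset Printing Implicit Defensive.

Import Order.TTheory GRing.Theory Num.Theory.
Import numFieldNormedType.Exports.

Local Open Scope classical_set_scope.
Local Open Scope ring_scope.

(* A record, and not an alias of [nat -> R], so that the pointwise ring
   structure of function types can never be inferred in place of the Cauchy
   product. *)
Record fps (R : Type) := Fps { fcoef : nat -> R }.

Definition fps_to_fun (R : Type) (f : fps R) : nat -> R := fcoef f.
Coercion fps_to_fun : fps >-> Funclass.

Lemma fpsP (R : Type) (f g : fps R) : f =1 g -> f = g.
Proof. by case: f g => f [g] /funext /= e; congr Fps. Qed.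

HB.instance Definition _ (R : Type) := gen_eqMixin (fps R).
HB.instance Definition _ (R : Type) := gen_choiceMixin (fps R).

Section FpsRing.
Variable R : comNzRingType.
Implicit Types f g h : fps R.

Definition fps_zero : fps R := Fps (fun=> 0).
Definition fps_opp f : fps R := Fps (fun n => - f n).
Definition fps_add f g : fps R := Fps (fun n => f n + g n).
Definition fps_one : fps R := Fps (fun n => (n == 0%N)%:R).
Definition fps_mul f g : fps R :=
  Fps (fun n => \sum_(i < n.+1) f i * g (n - i)%N).

Fact fps_addA : associative fps_add.
Proof. by move=> f g h; apply: fpsP => n; exact: addrA. Qed.
Fact fps_addC : commutative fps_add.
Proof. by move=> f g; apply: fpsP => n; exact: addrC. Qed.
Fact fps_add0 : left_id fps_zero fps_add.
Proof. by move=> f; apply: fpsP => n; exact: add0r. Qed.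
Fact fps_addN : left_inverse fps_zero fps_opp fps_add.
Proof. by move=> f; apply: fpsP => n; exact: addNr. Qed.

HB.instance Definition _ :=
  GRing.isZmodule.Build (fps R) fps_addA fps_addC fps_add0 fps_addN.

Definition fps_trunc d f : {poly R} := \poly_(i < d) f i.

Fact fps_mul_trunc d f g n : (n < d)%N ->
  fps_mul f g n = (fps_trunc d f * fps_trunc d g)`_n.
Proof.
move=> nd; rewrite coefM /=; apply: eq_bigr => i _.
by rewrite !coef_poly !ifT //; apply: leq_ltn_trans nd;
  rewrite ?leq_subr // -ltnS.
Qed.

Fact fps_mul_truncl d f (p : {poly R}) g n :
    (forall i, (i < d)%N -> f i = p`_i) -> (n < d)%N ->
  fps_mul f g n = (p * fps_trunc d g)`_n.
Proof.
move=> fp nd; rewrite coefM /=; apply: eq_bigr => i _.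
rewrite coef_poly fp ?ifT //; apply: leq_ltn_trans nd.
  by rewrite leq_subr.
by rewrite -ltnS.
Qed.

Fact fps_mulC : commutative fps_mul.
Proof.
by move=> f g; apply: fpsP => n; rewrite !(@fps_mul_trunc n.+1) // mulrC.
Qed.

Fact fps_mulA : associative fps_mul.
Proof.
move=> f g h; apply: fpsP => n; rewrite fps_mulC.
rewrite (@fps_mul_truncl n.+1 _ (fps_trunc n.+1 g * fps_trunc n.+1 h)) //;
  last by move=> i; exact: fps_mul_trunc.
rewrite (@fps_mul_truncl n.+1 _ (fps_trunc n.+1 f * fps_trunc n.+1 g)) //;
  last by move=> i; exact: fps_mul_trunc.
by rewrite mulrC mulrA.
Qed.

Fact fps_mul1 : left_id fps_one fps_mul.
Proof.
move=> f; apply: fpsP => n.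
rewrite (@fps_mul_truncl n.+1 _ 1) ?mul1r ?coef_poly ?ltnS ?leqnn //.
by move=> i _; rewrite coef1.
Qed.

Fact fps_mulD : left_distributive fps_mul fps_add.
Proof.
move=> f g h; apply: fpsP => n; rewrite /= -big_split /=.
by apply: eq_bigr => i _; rewrite mulrDl.
Qed.

Fact fps_one_neq0 : fps_one != 0.
Proof.
apply/eqP => /(congr1 (fun f : fps R => f 0%N)) /= /eqP.
by rewrite oner_eq0.
Qed.

HB.instance Definition _ := GRing.Zmodule_isComNzRing.Build (fps R)
  fps_mulA fps_mulC fps_mul1 fps_mulD fps_one_neq0.

Definition fpsC (c : R) : fps R := Fps (fun n => if n == 0%N then c else 0).
Definition fpsX : fps R := Fps (fun n => (n == 1%N)%:R).

Lemma fps_coefD f g n : (f + g) n = f n + g n. Proof. by []. Qed.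
Lemma fps_coefN f n : (- f) n = - f n. Proof. by []. Qed.
Lemma fps_coef1 n : (1 : fps R) n = (n == 0%N)%:R. Proof. by []. Qed.
Lemma fps_coefM f g n : (f * g) n = \sum_(i < n.+1) f i * g (n - i)%N.
Proof. by []. Qed.

Lemma fps_coef_sum (I : Type) (r : seq I) (P : pred I) (F : I -> fps R) n :
  (\sum_(i <- r | P i) F i) n = \sum_(i <- r | P i) F i n.
Proof.
by elim/big_rec2: _ => // i y1 y2 _ <-.
Qed.

Lemma fps_coefCM c f n : (fpsC c * f) n = c * f n.
Proof.
rewrite fps_coefM big_ord_recl /= subn0 big1 ?addr0 // => i _.
by rewrite mul0r.
Qed.

End FpsRing.

Section FpsUnit.
Variable R : comUnitRingType.
Implicit Types f g : fps R.

Definition fps_unit : {pred fps R} := [pred f : fps R | f 0%N \is a GRing.unit].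

(* Geometric series: 1 / f = c^-1 * sum_k (1 - c^-1 f)^k where c = f 0; the
   k-th power has order at least k, hence the finite sum in each coefficient. *)
Definition fps_geom f : fps R :=
  Fps (fun n => \sum_(k < n.+1) ((1 - fpsC (f 0%N)^-1 * f) ^+ k) n).

Definition fps_inv f : fps R :=
  if f \in fps_unit then fpsC (f 0%N)^-1 * fps_geom f else f.

Fact fps_exp_order f k n : f 0%N = 0 -> (n < k)%N -> (f ^+ k) n = 0.
Proof.
move=> f0; elim: k n => // k IH n nk; rewrite exprS fps_coefM big1 // => i _.
have [i0|i0] := posnP i; first by rewrite i0 f0 mul0r.
rewrite IH ?mulr0 //; have := ltn_ord i; rewrite ltnS => i_le_n.
by rewrite (leq_trans _ (nk : (n <= k)%N)) // ltn_subrL i0 (leq_trans i0).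
Qed.

Fact fps_mulVx : {in fps_unit, left_inverse 1 fps_inv *%R}.
Proof.
move=> f uf; rewrite /fps_inv uf; rewrite inE in uf.
rewrite mulrAC; set h := fpsC _ * f; pose g := 1 - h.
have -> : h = 1 - g by rewrite /g opprB addrCA subrr addr0.
have g0 : g 0%N = 0.
  by rewrite /g fps_coefD fps_coefN fps_coefCM mulVr // fps_coef1 subrr.
have gE m n : (m <= n)%N ->
    fps_geom f m = (\sum_(k < n.+1) g ^+ k) m.
  move=> mn; rewrite fps_coef_sum -(subnKC mn) -addSn big_split_ord /=.
  rewrite -[LHS]addr0; congr (_ + _); rewrite big1 // => i _.
  by apply: fps_exp_order => //=; rewrite addSn ltnS leq_addr.
apply: fpsP => n.
transitivity (((1 - g) * \sum_(k < n.+1) g ^+ k) n).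
  by rewrite !fps_coefM; apply: eq_bigr => i _; rewrite (gE _ n) // leq_subr.
rewrite -opprB mulNr -subrX1 opprB fps_coefD fps_coefN fps_exp_order //.
by rewrite subr0.
Qed.

Fact fps_unitPl f g : g * f = 1 -> fps_unit f.
Proof.
move=> /(congr1 (fun h : fps R => h 0%N)).
rewrite fps_coefM big_ord_recl big_ord0 addr0 fps_coef1 /= => gf.
by rewrite /fps_unit /=; apply/unitrPr; exists (g 0%N); rewrite mulrC.
Qed.

Fact fps_inv_out : {in [predC fps_unit], fps_inv =1 id}.
Proof. by move=> f; rewrite !inE /fps_inv inE => /negbTE ->. Qed.

HB.instance Definition _ := GRing.ComNzRing_hasMulInverse.Build (fps R)
  fps_mulVx fps_unitPl fps_inv_out.

Lemma fps_unitE f : (f \is a GRing.unit) = (f 0%N \is a GRing.unit).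
Proof. by []. Qed.

End FpsUnit.

(* R[[u,v]] is represented as R[[u]][[v]]. *)
Definition fps2 (R : comUnitRingType) : comUnitRingType := fps (fps R).

Definition fpsU (R : comUnitRingType) : fps2 R := fpsC (fpsX R).
Definition fpsV (R : comUnitRingType) : fps2 R := fpsX (fps R).
Definition fps2C (R : comUnitRingType) (c : R) : fps2 R := fpsC (fpsC c).

(* The coefficient of u^p v^q. *)
Definition fps2_coef (R : comUnitRingType) (f : fps2 R) (p q : nat) : R :=
  (f : fps (fps R)) q p.

(* Coefficientwise infinite sums. *)
Definition fps2_partial (R : realType) (T : nat -> fps2 R) (p q : nat) :
    nat -> R :=
  fun n => fps2_coef (\sum_(0 <= j < n) T j) p q.

Definition fps2_summable (R : realType) (T : nat -> fps2 R) : Prop :=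
  forall p q, cvgn (fps2_partial T p q).

Definition fps2_sum (R : realType) (T : nat -> fps2 R) : fps2 R :=
  Fps (fun q => Fps (fun p => limn (fps2_partial T p q))).

Definition pochhammer (A : nzRingType) (b : A) (j : nat) : A :=
  \prod_(0 <= i < j) (b + i%:R).

Definition hyp3F2_term (A : comUnitRingType) (b1 b2 b3 c1 c2 z : A) (j : nat) :
    A :=
  pochhammer b1 j * pochhammer b2 j * pochhammer b3 j
    / (pochhammer c1 j * pochhammer c2 j) * (z ^+ j / j`!%:R).

Definition hyp3F2 (R : realType) (b1 b2 b3 c1 c2 z : fps2 R) : fps2 R :=
  fps2_sum (hyp3F2_term b1 b2 b3 c1 c2 z).

(* The index set m_1 >= ... >= m_n > 0, m_i = a mod N. *)
Definition tstar_index (N a n : nat) : set (seq nat) :=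
  [set m | size m = n /\ sorted geq m /\
           forall x, x \in m -> (0 < x)%N /\ x = a %[mod N]].

Definition tstar_term (R : realType) (ks m : seq nat) : R :=
  (\prod_(i < size ks) (nth 0%N m i)%:R ^+ nth 0%N ks i)^-1.

Definition tstar_summable (R : realType) (N a : nat) (ks : seq nat) : Prop :=
  summable (tstar_index N a (size ks)) (fun m => (tstar_term R ks m)%:E).

(* [fine] sends an infinite sum to 0, so this is meaningful only under
   [tstar_summable]. *)
Definition tstar (R : realType) (N a : nat) (ks : seq nat) : R :=
  fine (\esum_(m in tstar_index N a (size ks)) (tstar_term R ks m)%:E).

(* The terms with a given k in the double sum over n >= 1 and k >= n + 1. *)
Definition tstar_gen_term (R : realType) (N a k : nat) : fps2 R :=
  \sum_(1 <= n < k)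
     fps2C (tstar R N a ((k - n + 1)%N :: nseq (n - 1) 1%N))
       * fpsU R ^+ (k - n - 1) * fpsV R ^+ (n - 1).

Lemma fps2_coefUV (R : comUnitRingType) (c : R) i j p q :
  fps2_coef (fps2C c * fpsU R ^+ i * fpsV R ^+ j) p q
  = if (p == i) && (q == j) then c else 0.
Proof.
have XnE (A : comNzRingType) k n : (fpsX A ^+ k) n = (n == k)%:R.
  elim: k n => [|k IH] n; first by rewrite expr0 fps_coef1.
  rewrite exprS fps_coefM; case: n => [|n].
    by rewrite big_ord_recl big_ord0 /= mul0r addr0.
  rewrite 2!big_ord_recl /= mul0r add0r mul1r big1 ?addr0 => [|l _].
    by rewrite IH /bump /= subn1.
  by rewrite mul0r.
have CX (A : comNzRingType) (x : A) k : fpsC x ^+ k = fpsC (x ^+ k).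
  elim: k => [|k IH]; first by apply: fpsP => -[].
  by apply: fpsP => n; rewrite !exprS IH fps_coefCM /=; case: n => //= n; rewrite mulr0.
rewrite /fpsU /fpsV /fps2C /fps2_coef CX -mulrA.
rewrite !fps_coefCM XnE.
rewrite mulr_natr; case: (q == j); rewrite ?andbT ?andbF ?mulr1n ?mulr0n.
  by rewrite XnE mulr_natr; case: eqP.
by rewrite mulr0.
Qed.

(* Main.v *)
(* Write m_j = a + N j.  Summing the geometric series in u and the generating
   function of the complete homogeneous symmetric polynomials in v over the
   tuples with m_1 = m_j turns the left-hand side into
     \sum_j 1 / (m_j (m_j - u)) \prod_(i <= j) m_i / (m_i - v),
   and the j-th term of this series is, as a formal power series, exactly
   1 / ((a - u) (a - v)) times the j-th term of the hypergeometric series. *)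
Require Import Defs.
From mathcomp Require Import all_boot all_order all_algebra.
From mathcomp Require Import boolp classical_sets functions reals ereal.
From mathcomp Require Import topology normedtype sequences esum.
From mathcomp Require Import cardinality fsbigop.
From mathcomp Require Import zify ring lra.

Set Implicit Arguments.
Unset Strict Implicit.
Unset Printing Implicit Defensive.

Import Order.TTheory GRing.Theory Num.Theory.
Import numFieldNormedType.Exports.

Local Open Scope classical_set_scope.
Local Open Scope ring_scope.

(** * Complete homogeneous symmetric polynomials and a growth bound *)

(* The complete homogeneous symmetric polynomial of degree q in
   x 0, ..., x (n - 1). *)
Fixpoint hsym (R : pzRingType) (x : nat -> R) (n : nat) : nat -> R :=
  if n is n'.+1 then
    fix hsym_succ q :=
      if q is q'.+1 then hsym x n' q + x n' * hsym_succ q' else 1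
  else fun q => (q == 0%N)%:R.

Lemma hsym0 (R : pzRingType) (x : nat -> R) n : hsym x n 0 = 1.
Proof. by case: n. Qed.

Lemma hsymS (R : pzRingType) (x : nat -> R) n q :
  hsym x n.+1 q.+1 = hsym x n q.+1 + x n * hsym x n.+1 q.
Proof. by []. Qed.

Lemma hsym_ge0 (R : numDomainType) (x : nat -> R) n q :
  (forall i, 0 <= x i) -> 0 <= hsym x n q.
Proof.
move=> x0; elim: n q => [|n IHn] q; first by rewrite /= ler0n.
by elim: q => [|q IHq] //; rewrite hsymS addr_ge0 // mulr_ge0.
Qed.

(** The left side is a single term of the expansion of the product on the right in powers of [t],
    all of whose terms are nonnegative. A double induction along [hsymS] replaces the infinite
    expansion. *)
Lemma hsym_exp_le (R : numFieldType) (x : nat -> R) (t : R) n q :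
  0 <= t -> (forall i, 0 <= x i) -> (forall i, t * x i < 1) ->
  t ^+ q * hsym x n q <= \prod_(i < n) (1 - t * x i)^-1.
Proof.
move=> t0 x0 tx1.
have prod_ge0 k : 0 <= \prod_(i < k) (1 - t * x i)^-1.
  by apply: prodr_ge0 => i _; rewrite invr_ge0 subr_ge0 ltW.
elim: n q => [|n IHn] q.
  by rewrite big_ord0 /=; case: q => [|q]; rewrite ?expr0 ?mulr1 ?mulr0.
have d0 : 0 < 1 - t * x n by rewrite subr_gt0.
elim: q => [|q IHq].
  rewrite big_ord_recr /= expr0 mulr1 ler_pdivlMr // mul1r.
  apply: le_trans (IHn 0%N); rewrite expr0 hsym0 mulr1.
  by rewrite lerBlDr lerDl mulr_ge0.
set P := \prod_(i < n.+1) _ in IHq *.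
(* The product obeys the recursion of [hsymS], because 1/(1 - y) = 1 + y/(1 - y). *)
have PE : P = \prod_(i < n) (1 - t * x i)^-1 + t * x n * P.
  rewrite /P big_ord_recr /=; field.
  by rewrite gt_eqF.
rewrite hsymS mulrDr [X in _ <= X]PE lerD // exprS.
rewrite (_ : _ * _ = t * x n * (t ^+ q * hsym x n.+1 q)); last by ring.
by rewrite ler_wpM2l // mulr_ge0.
Qed.

(** * Enumeration of nonincreasing tuples with bounded entries *)

Lemma geq_trans : transitive geq.
Proof. by move=> y x z /= xy yz; exact: leq_trans yz xy. Qed.

Section NonincreasingSequences.
Variable m : nat -> nat.
Hypothesis m_lt : {mono m : i j / (i < j)%N}.

(** The nested recursion copies that of [hsym]: either the largest allowed value [m n'] does not
    occur, or it is the head and may occur again in the tail. *)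
Fixpoint nonincr_seqs (n : nat) : nat -> seq (seq nat) :=
  if n is n'.+1 then
    fix nonincr_seqs_succ q :=
      if q is q'.+1 then
        nonincr_seqs n' q ++ [seq m n' :: s | s <- nonincr_seqs_succ q']
      else [:: [::]]
  else fun q => if q is 0%N then [:: [::]] else [::].

Lemma nonincr_seqs0 n : nonincr_seqs n 0 = [:: [::]].
Proof. by case: n. Qed.

Lemma nonincr_seqsS n q : nonincr_seqs n.+1 q.+1 =
  nonincr_seqs n q.+1 ++ [seq m n :: s | s <- nonincr_seqs n.+1 q].
Proof. by []. Qed.

Lemma mem_nonincr_seqs n q s : (s \in nonincr_seqs n q) =
  [&& size s == q, sorted geq s & all (mem [seq m i | i <- iota 0 n]) s].
Proof.
have m_le : {mono m : i j / (i <= j)%N}.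
  by move=> i j; rewrite leqNgt m_lt -leqNgt.
elim: n q s => [|n IHn] q s.
  by case: q s => [|q] [|y s] //=; rewrite !andbF.
elim: q s => [|q IHq] [|y s] //.
  rewrite nonincr_seqsS mem_cat IHn /=.
  by apply/mapP => -[].
rewrite nonincr_seqsS mem_cat IHn.
have -> : (y :: s \in [seq m n :: z | z <- nonincr_seqs n.+1 q]) =
    (y == m n) && (s \in nonincr_seqs n.+1 q).
  apply/mapP/andP => [[z zs [-> ->]]|[/eqP -> ss]]; last by exists s.
  by rewrite eqxx.
rewrite IHq -{1 2}(addn1 n) iotaD map_cat add0n.
set I := [seq m i | i <- iota 0 n].
rewrite /= eqSS; case: eqP => //= _; last by rewrite andbF.
rewrite (path_sortedE geq_trans).
have memI z : (z \in I ++ [:: m n]) = (z \in I) || (z == m n).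
  by rewrite mem_cat inE.
have -> : all [in I ++ [:: m n]] s = all [predU1 (m n) & I] s.
  by apply: eq_all => z /=; rewrite memI orbC.
rewrite memI.
(* If the head is [m n], it is not among the smaller values, so only the second half of the list
   matters; it bounds all later entries automatically. *)
have [->|yn] /= := eqVneq y (m n).
  have -> : m n \in I = false.
    apply/mapP => -[i]; rewrite mem_iota => /andP[_ /=]; rewrite -m_lt => lt E.
    by rewrite E ltnn in lt.
  rewrite andbF /= andbC; case: allP => //= h; rewrite ?andbF // andbT.
  rewrite (_ : all _ s = true) //; apply/allP => z /h /=.
  case/orP => [/eqP -> //|/mapP[i]]; rewrite mem_iota add0n => /andP[_ lt] ->.
  by rewrite /geq /= m_le ltnW.
(* If the head [y] is a smaller value, then [y < m n], and sortedness keeps [m n] out of the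
   tail. *)
rewrite !orbF; case yI: (y \in I); rewrite /= ?andbF //=.
case gy: (all (geq y) s) => //=; case: sorted => //=.
apply: eq_in_all => z /(allP gy) /= zy.
rewrite [RHS](_ : _ = (z == m n) || (z \in I)) //.
have [zn|//] := eqVneq z (m n).
case/mapP: yI => i; rewrite mem_iota -m_lt => /andP[_] lt yE.
by move: zy; rewrite zn yE leqNgt lt.
Qed.

Lemma uniq_nonincr_seqs n q : uniq (nonincr_seqs n q).
Proof.
elim: n q => [|n IHn] q; first by case: q.
elim: q => [|q IHq] //; rewrite nonincr_seqsS cat_uniq IHn.
rewrite map_inj_uniq ?IHq ?andbT /=; last by move=> s t [].
apply/hasPn => _ /mapP[s _ ->] /=; rewrite mem_nonincr_seqs /=.
apply/negP => /and3P[_ _ /andP[/mapP[i]]].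
by rewrite mem_iota -m_lt => /andP[_] /[swap] <-; rewrite ltnn.
Qed.

(** Nonincreasing tuples index the monomials of degree [q], which ties the recursive [hsym] to sums
    over tuples. *)
Lemma sum_nonincr_seqs (R : pzRingType) (f : nat -> R) n q :
  \sum_(s <- nonincr_seqs n q) \prod_(y <- s) f y = hsym (f \o m) n q.
Proof.
elim: n q => [|n IHn] q.
  by case: q => [|q]; rewrite ?big_seq1 ?big_nil.
elim: q => [|q IHq]; first by rewrite nonincr_seqs0 hsym0 big_seq1 big_nil.
rewrite nonincr_seqsS big_cat hsymS IHn big_map -IHq; congr (_ + _).
by rewrite mulr_sumr; apply: eq_bigr => s _; rewrite big_cons.
Qed.

End NonincreasingSequences.

Arguments hsym : simpl never.
Arguments nonincr_seqs : simpl never.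

(** * The star values as single series over the largest index *)

Lemma esum_seq (R : realType) (T : choiceType) (l : seq T) (f : T -> R) :
  uniq l -> (forall s, 0 <= f s) ->
  (\esum_(s in [set` l]) (f s)%:E)%E = (\sum_(s <- l) f s)%:E.
Proof.
move=> ul f0; rewrite esum_fset; first last.
- by move=> s _; rewrite lee_fin.
- exact: finite_seq.
by rewrite -fsbig_seq // sumEFin.
Qed.

Section ArithmeticProgression.
Variables (N a : nat).
Hypotheses (hN : (0 < N)%N) (ha : (1 <= a <= N)%N).

Definition aprog (i : nat) : nat := (a + N * i)%N.

Lemma aprog_gt0 i : (0 < aprog i)%N.
Proof. by rewrite addn_gt0; case/andP: ha => ->. Qed.

Lemma aprog_mono : {mono aprog : i j / (i < j)%N}.
Proof. by move=> i j; rewrite ltn_add2l ltn_pmul2l. Qed.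

Lemma aprogP x : (0 < x)%N /\ x = a %[mod N] <-> exists i, x = aprog i.
Proof.
split=> [[x0 xa]|[i ->]]; last first.
  by split; [exact: aprog_gt0|rewrite /aprog mulnC addnC modnMDl].
have ax : (a <= x)%N.
  (* The case [a = N] is separate: there the residue is 0, so [a] is not its own remainder. *)
  have [aN|aN] := eqVneq a N.
    by rewrite aN dvdn_leq // /dvdn xa aN modnn.
  have ltaN : (a < N)%N by rewrite ltn_neqAle aN; case/andP: ha.
  by rewrite -(modn_small ltaN) -xa leq_mod.
have /dvdnP[i xi] : (N %| x - a)%N.
  by rewrite -eqn_mod_dvd //; apply/eqP.
by exists i; rewrite /aprog mulnC -xi subnKC.
Qed.

(** The tuples are grouped by their largest entry [aprog j]. Later entries may equal it, so the tail
    uses the [j.+1] values up to and including [aprog j]. *)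
Lemma tstar_indexE q : tstar_index N a q.+1 =
  \bigcup_j [set` [seq aprog j :: s | s <- nonincr_seqs aprog j.+1 q]].
Proof.
apply/seteqP; split => [[|y s]|t [j _] /= /mapP[s]]; first by case.
  move=> [/= [sq] [srt hs]].
  have [j yj] : exists i, y = aprog i by apply/aprogP/hs; rewrite mem_head.
  exists j => //=; rewrite {}yj in srt hs *; apply/map_f.
  rewrite mem_nonincr_seqs ?sq ?eqxx /=; last exact: aprog_mono.
  move: srt; rewrite (path_sortedE geq_trans) => /andP[/allP le_s ->] /=.
  apply/allP => z zs; have [i zi] : exists i, z = aprog i.
    by apply/aprogP/hs; rewrite inE zs orbT.
  have := le_s _ zs; rewrite /= zi => le_ij.
  suff : aprog i \in [seq aprog i | i <- iota 0 j.+1] by [].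
  apply: map_f; rewrite mem_iota /= add0n ltnS leqNgt -aprog_mono -leqNgt.
  exact: le_ij.
rewrite mem_nonincr_seqs; last exact: aprog_mono.
move=> /and3P[/eqP sq srt /allP sI] ->{t}.
have {}sI z : z \in s -> exists2 i, (i <= j)%N & z = aprog i.
  by move=> /sI /mapP[i]; rewrite mem_iota ltnS => /= ij ->; exists i.
split; first by rewrite /= sq.
split.
  rewrite /= (path_sortedE geq_trans) srt andbT; apply/allP => z /sI[i ij ->].
  by rewrite /= leqNgt aprog_mono -leqNgt.
move=> z; rewrite inE => /predU1P[->|/sI[i _ ->]]; apply/aprogP.
  by exists j.
by exists i.
Qed.

Variable R : realType.

Lemma tstar_term_cons k q y s : size s = q ->
  tstar_term R (k :: nseq q 1%N) (y :: s)
  = y%:R^-1 ^+ k * \prod_(z <- s) z%:R^-1.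
Proof.
move=> sq; rewrite /tstar_term /= big_ord_recl /= invfM exprVn; congr (_ * _).
rewrite size_nseq prodfV; congr (_^-1); rewrite (big_nth 0%N) big_mkord sq.
by apply: eq_bigr => i _; rewrite nth_nseq ltn_ord expr1.
Qed.

Lemma tstar_term_ge0 ks s : 0 <= tstar_term R ks s.
Proof. by rewrite invr_ge0 prodr_ge0 // => i _; rewrite exprn_ge0. Qed.

Definition aprogV (i : nat) : R := (aprog i)%:R^-1.

(** The total contribution to the star value with exponents k, 1, ..., 1 ([q] ones) of the tuples
    whose first entry is [aprog j]. *)
Definition tstar_summand (k q j : nat) : R :=
  aprogV j ^+ k * hsym aprogV j.+1 q.

Lemma aprogV_ge0 i : 0 <= aprogV i.
Proof. by rewrite invr_ge0 ler0n. Qed.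

Lemma tstar_summand_ge0 k q j : 0 <= tstar_summand k q j.
Proof.
by rewrite mulr_ge0 ?exprn_ge0 ?hsym_ge0 // => *; exact: aprogV_ge0.
Qed.

Lemma esum_tstar_term k q :
  (\esum_(s in tstar_index N a q.+1) (tstar_term R (k :: nseq q 1%N) s)%:E
  = \sum_(0 <= j <oo) (tstar_summand k q j)%:E)%E.
Proof.
rewrite tstar_indexE nneseries_sum_bigcup; first last.
- by move=> s; rewrite lee_fin tstar_term_ge0.
- move=> i j _ _ [s [/= /mapP[t _ ->] /mapP[t' _]]] [].
  by move=> /eqP; rewrite eqn_add2l eqn_pmul2l // => /eqP.
apply: eq_eseriesr => j _; rewrite esum_seq; first last.
- by move=> s; exact: tstar_term_ge0.
- rewrite map_inj_uniq; last by move=> s t [].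
  by rewrite uniq_nonincr_seqs //; exact: aprog_mono.
rewrite big_map /tstar_summand -(sum_nonincr_seqs aprog (fun y => y%:R^-1)).
rewrite mulr_sumr; congr EFin; apply: eq_big_seq => s.
rewrite mem_nonincr_seqs; last exact: aprog_mono.
by case/and3P => /eqP sq _ _; rewrite tstar_term_cons.
Qed.

(* By hsym_exp_le at t = 1/2, hsym is at most 2^q P_j, where
   P_j = \prod_(i <= j) m_i / (m_i - 1/2), and P_j / m_j^2 is dominated by a
   multiple of the telescoping difference P_j / m_j - P_(j+1) / m_(j+1). *)
Lemma tstar_summand_bounded k q : (2 <= k)%N ->
  exists B, forall n, \sum_(0 <= j < n) tstar_summand k q j <= B.
Proof.
move=> k2; pose h : R := 2^-1.
have m1 i : 1 <= (aprog i)%:R :> R by rewrite ler1n aprog_gt0.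
have V0 := aprogV_ge0.
have V1 i : aprogV i <= 1.
  by rewrite invf_le1 ?m1 // (lt_le_trans ltr01).
have h0 : 0 < h by rewrite invr_gt0.
have hV i : h * aprogV i < 1.
  by have := V1 i; have := V0 i; rewrite /h; lra.
pose P n : R := \prod_(i < n) (1 - h * aprogV i)^-1.
have P0 n : 0 <= P n.
  by apply: prodr_ge0 => i _; rewrite invr_ge0 subr_ge0 ltW.
pose Q j := P j.+1 * aprogV j.
have step j : aprogV j ^+ 2 * P j.+1 <= 4 * (Q j - Q j.+1).
  have -> : Q j - Q j.+1 =
      P j.+1 * (aprogV j - aprogV j.+1 / (1 - h * aprogV j.+1)).
    by rewrite /Q {2}/P big_ord_recr /= -/(P j.+1) mulrBr mulrA mulrAC.
  rewrite mulrCA [X in X <= _]mulrC ler_wpM2l //.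
  set b := (aprog j)%:R : R; have b1 : 1 <= b := m1 j.
  have n1 : 1 <= N%:R :> R by rewrite ler1n.
  have bS : (aprog j.+1)%:R = b + N%:R :> R.
    by rewrite -natrD; congr (_%:R); rewrite /aprog; lia.
  rewrite /aprogV bS -/b /h.
  have -> : 4 * (b^-1 - (b + N%:R)^-1 / (1 - 2^-1 * (b + N%:R)^-1)) =
     b^-1 ^+ 2 * (4 * b * (2 * N%:R - 1) / (2 * b + 2 * N%:R - 1)).
    by field; rewrite ?gt_eqF //=; lra.
  rewrite ler_peMr ?exprn_ge0 // ?invr_ge0; first lra.
  rewrite ler_pdivlMr ?mul1r; last by lra.
  (* The factor 4 is large enough because 4b(2N - 1) - (2b + 2N - 1) = 6b(N - 1) + 2N(b - 1) + 1,
     which is positive. *)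
  by nra.
have bnd j : tstar_summand k q j <= 2 ^+ q * (4 * (Q j - Q j.+1)).
  have le1 : aprogV j ^+ k <= aprogV j ^+ 2.
    by rewrite ler_wiXn2l // V0.
  have le2 : hsym aprogV j.+1 q <= 2 ^+ q * P j.+1.
    have := hsym_exp_le j.+1 q (ltW h0) V0 hV.
    by rewrite exprVn -ler_pdivlMl ?invr_gt0 ?exprn_gt0 // invrK.
  apply: le_trans (_ : aprogV j ^+ 2 * (2 ^+ q * P j.+1) <= _).
    by rewrite ler_pM ?exprn_ge0 ?hsym_ge0.
  by rewrite mulrCA ler_wpM2l ?exprn_ge0.
exists (2 ^+ q * (4 * Q 0%N)) => n.
apply: le_trans (ler_sum_nat (fun j _ => bnd j)) _.
rewrite -mulr_sumr ler_wpM2l ?exprn_ge0 // -mulr_sumr ler_wpM2l //.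
under eq_bigr do rewrite -opprB.
by rewrite sumrN telescope_sumr // opprB gerBl mulr_ge0.
Qed.

Lemma summable_tstar_summand k q : (2 <= k)%N ->
  summable setT (fun j => (tstar_summand k q j)%:E).
Proof.
move=> k2; have [B hB] := tstar_summand_bounded q k2.
rewrite /summable.
under eq_esum do rewrite gee0_abs ?lee_fin ?tstar_summand_ge0 //.
rewrite -nneseries_esumT; last by move=> j; rewrite lee_fin tstar_summand_ge0.
apply: le_lt_trans (ltry B); apply: lime_le.
  by apply: is_cvg_nneseries => j _ _; rewrite lee_fin tstar_summand_ge0.
by apply: nearW => n; rewrite sumEFin lee_fin.
Qed.

Lemma is_cvg_tstar_summand k q : (2 <= k)%N ->
  cvgn (fun n => \sum_(0 <= j < n) tstar_summand k q j).
Proof.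
move=> k2; have := @summable_cvg R xpredT (fun j => (tstar_summand k q j)%:E).
apply; last by rewrite fun_true; exact: summable_tstar_summand.
by move=> j _; rewrite lee_fin tstar_summand_ge0.
Qed.

Lemma nneseries_tstar_summand k q : (2 <= k)%N ->
  (\sum_(0 <= j <oo) (tstar_summand k q j)%:E
   = (limn (fun n => \sum_(0 <= j < n) tstar_summand k q j)%R)%:E)%E.
Proof.
move=> k2.
have := @summable_nneseries_lim R xpredT (fun j => (tstar_summand k q j)%:E).
apply; last by rewrite fun_true; exact: summable_tstar_summand.
by move=> j _; rewrite lee_fin tstar_summand_ge0.
Qed.

Lemma tstar_summable_cons k q : (2 <= k)%N ->
  tstar_summable R N a (k :: nseq q 1%N).
Proof.
move=> k2; rewrite /tstar_summable /= size_nseq /summable.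
under eq_esum do rewrite gee0_abs ?lee_fin ?tstar_term_ge0 //.
by rewrite esum_tstar_term nneseries_tstar_summand // ltry.
Qed.

(** The extended sum is a finite real limit, so [fine] returns that limit and not its default
    value. *)
Lemma tstar_consE k q : (2 <= k)%N -> tstar R N a (k :: nseq q 1%N) =
  limn (fun n => \sum_(0 <= j < n) tstar_summand k q j).
Proof.
move=> k2; rewrite /tstar /= size_nseq.
by rewrite esum_tstar_term nneseries_tstar_summand.
Qed.

End ArithmeticProgression.

(** * Coefficientwise sums and multiplication by a fixed series *)

Section FpsSums.

Lemma fps2_coefM (R : comUnitRingType) (f g : fps2 R) p q :
  fps2_coef (f * g) p q = \sum_(j < q.+1) \sum_(i < p.+1)
    fps2_coef f i j * fps2_coef g (p - i) (q - j).
Proof. by rewrite /fps2_coef fps_coefM fps_coef_sum. Qed.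

Lemma fps2_coef_sum (R : comUnitRingType) (I : Type) (r : seq I) (P : pred I)
    (F : I -> fps2 R) p q :
  fps2_coef (\sum_(i <- r | P i) F i) p q =
  \sum_(i <- r | P i) fps2_coef (F i) p q.
Proof. by rewrite /fps2_coef !fps_coef_sum. Qed.

Lemma fps2P (R : comUnitRingType) (f g : fps2 R) :
  (forall p q, fps2_coef f p q = fps2_coef g p q) -> f = g.
Proof. by move=> fg; apply: fpsP => q; apply: fpsP => p; exact: fg. Qed.

Variable R : realType.
Implicit Types (K : fps2 R) (T : nat -> fps2 R).

Lemma fps2_partialE T p q n :
  fps2_partial T p q n = \sum_(0 <= j < n) fps2_coef (T j) p q.
Proof. exact: fps2_coef_sum. Qed.

(** Each coefficient of a product by [K] is a finite linear combination of coefficients of the other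
    factor, so it passes to the limit. *)
Lemma fps2_partial_mul K T p q : fps2_summable T ->
  fps2_partial (fun j => K * T j) p q @ \oo -->
  fps2_coef (K * fps2_sum T) p q.
Proof.
move=> sT; rewrite fps2_coefM.
have -> : fps2_partial (fun j => K * T j) p q = fun n =>
    \sum_(j < q.+1) \sum_(i < p.+1)
      fps2_coef K i j * fps2_partial T (p - i) (q - j) n.
  by apply: funext => n; rewrite /fps2_partial -mulr_sumr fps2_coefM.
apply: cvg_big; first exact: add_continuous.
move=> j _; apply: cvg_big; first exact: add_continuous.
by move=> i _; apply: cvgM; [exact: cvg_cst|exact: sT].
Qed.

Lemma fps2_summable_mul K T :
  fps2_summable T -> fps2_summable (fun j => K * T j).
Proof. by move=> sT p q; apply: cvgP; exact: fps2_partial_mul sT. Qed.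

Lemma fps2_sum_mul K T : fps2_summable T ->
  fps2_sum (fun j => K * T j) = K * fps2_sum T.
Proof.
move=> sT; apply: fps2P => p q.
by apply: cvg_lim => //; exact: fps2_partial_mul.
Qed.

End FpsSums.

(** * Coefficients of elementary products and sums in u and v *)

Section FpsVariables.
Variable R : comUnitRingType.
Implicit Types f : fps2 R.

Lemma fps_coefXM (A : comNzRingType) (f : fps A) n :
  (fpsX A * f) n = if n is n'.+1 then f n' else 0.
Proof.
rewrite fps_coefM; case: n => [|n].
  by rewrite big_ord_recl big_ord0 /= mul0r addr0.
rewrite 2!big_ord_recl /= mul0r add0r mul1r big1 ?addr0 => [|l _].
  by rewrite /bump /= subn1.
by rewrite mul0r.
Qed.

Lemma fps2_coefUM f p q :
  fps2_coef (fpsU R * f) p q = if p is p'.+1 then fps2_coef f p' q else 0.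
Proof. by rewrite /fps2_coef fps_coefCM fps_coefXM. Qed.

Lemma fps2_coefVM f p q :
  fps2_coef (fpsV R * f) p q = if q is q'.+1 then fps2_coef f p q' else 0.
Proof. by rewrite /fps2_coef fps_coefXM; case: q. Qed.

Lemma fps2_coefD f g p q :
  fps2_coef (f + g) p q = fps2_coef f p q + fps2_coef g p q.
Proof. by []. Qed.

Lemma fps2_coefN f p q : fps2_coef (- f) p q = - fps2_coef f p q.
Proof. by []. Qed.

Lemma fps2_coefMn f n p q : fps2_coef (f *+ n) p q = fps2_coef f p q *+ n.
Proof.
by elim: n => [|n IH]; rewrite ?mulr0n // !mulrSr fps2_coefD IH.
Qed.

Lemma fps2_coef1 p q :
  fps2_coef (1 : fps2 R) p q = ((p == 0%N) && (q == 0%N))%:R.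
Proof. by rewrite /fps2_coef fps_coef1; case: q; case: p. Qed.

Lemma fps2_coef_natM n f p q :
  fps2_coef (n%:R * f) p q = n%:R * fps2_coef f p q.
Proof. by rewrite !mulr_natl fps2_coefMn. Qed.

End FpsVariables.

(** * The ratio of consecutive hypergeometric terms *)

Section Hypergeometric.
Variable A : comUnitRingType.
Implicit Types b c z : A.

Lemma pochhammer_unit b n : (forall i, b + i%:R \is a GRing.unit) ->
  pochhammer b n \is a GRing.unit.
Proof.
move=> ub; rewrite /pochhammer; elim/big_rec: _ => [|i y _ uy].
  exact: unitr1.
by rewrite unitrM ub.
Qed.

Lemma hyp3F2_term0 b1 b2 b3 c1 c2 z : hyp3F2_term b1 b2 b3 c1 c2 z 0 = 1.
Proof. by rewrite /hyp3F2_term /pochhammer !big_nil expr0 !(mulr1, divr1). Qed.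

Lemma hyp3F2_termS b1 b2 b3 c1 c2 z j :
    pochhammer c1 j.+1 \is a GRing.unit ->
    pochhammer c2 j.+1 \is a GRing.unit ->
    (j.+1)`!%:R \is a @GRing.unit A ->
  hyp3F2_term b1 b2 b3 c1 c2 z j.+1 =
  hyp3F2_term b1 b2 b3 c1 c2 z j *
    ((b1 + j%:R) * (b2 + j%:R) * (b3 + j%:R) * z
       / ((c1 + j%:R) * (c2 + j%:R) * (1 + j%:R))).
Proof.
have pS b : pochhammer b j.+1 = pochhammer b j * (b + j%:R).
  by rewrite /pochhammer big_nat_recr.
rewrite /hyp3F2_term !pS factS natrM -[j.+1]add1n natrD exprD expr1.
rewrite !unitrM => /andP[u1 u2] /andP[u3 u4] /andP[u5 u6].
rewrite !invrM ?unitrM ?u1 ?u2 ?u3 ?u4 ?u5 ?u6 //.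
by ring.
Qed.

(** The upper parameter 1 cancels the new factor of the factorial, and the two factors 1/[m] above
    cancel the two below. The ratio is cleared of denominators so that it can be compared by
    cancelling units. *)
Lemma hyp3F2_term_ratio (a m u v : A) j :
    m \is a GRing.unit ->
    (forall i, a + m * i.+1%:R - u \is a GRing.unit) ->
    (forall i, a + m * i.+1%:R - v \is a GRing.unit) ->
    (forall n, (0 < n)%N -> n%:R \is a @GRing.unit A) ->
  let T :=
    hyp3F2_term (a / m) ((a - u) / m) 1 ((a + m - u) / m) ((a + m - v) / m) 1 in
  T j.+1 * ((a + m * j.+1%:R - u) * (a + m * j.+1%:R - v)) =
  T j * ((a + m * j%:R) * (a + m * j%:R - u)).
Proof.
move=> um uu uv un T.
have shift b i : b / m + i%:R = (b + m * i%:R) / m.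
  by rewrite mulrDl [m * _]mulrC mulrK.
(* The lower parameters already contain one [m], hence the shift to [i.+1]. *)
have shiftS b i : (a + m - b) / m + i%:R = (a + m * i.+1%:R - b) / m.
  by rewrite shift -[i.+1]add1n natrD; congr (_ / _); ring.
rewrite {1}/T hyp3F2_termS -/T; last exact/un/fact_gt0; last first.
- by apply: pochhammer_unit => i; rewrite shiftS unitrM uv unitrV.
- by apply: pochhammer_unit => i; rewrite shiftS unitrM uu unitrV.
rewrite -mulrA; congr (_ * _).
set den := (X in _ / X); have uden : den \is a GRing.unit.
  by rewrite /den !shiftS !unitrM uu uv unitrV um nat1r un.
apply: (mulIr uden); rewrite mulrAC divrK // /den !shiftS !shift.
by ring.
Qed.

End Hypergeometric.

(** * Matching the terms of the two sides *)

Section GeneratingTerms.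
Variables (R : realType) (N a : nat).
Hypotheses (hN : (0 < N)%N) (ha : (1 <= a <= N)%N).

Local Notation u := (fpsU R).
Local Notation v := (fpsV R).
Local Notation m := (aprog N a).
Local Notation x := (aprogV N a R).

(** Invertibility is decided by the constant coefficient, here the nonzero real [n]. *)
Lemma fps2_natBr_unit n (f : fps2 R) :
  (0 < n)%N -> fps2_coef f 0 0 = 0 -> (n%:R - f) \is a GRing.unit.
Proof.
move=> n0 f0; rewrite !fps_unitE.
change (fps2_coef (n%:R - f) 0 0 \is a GRing.unit).
rewrite fps2_coefD fps2_coefN f0 subr0.
by rewrite fps2_coefMn fps2_coef1 unitfE pnatr_eq0 -lt0n.
Qed.

Lemma fps2_nat_unit n : (0 < n)%N -> (n%:R : fps2 R) \is a GRing.unit.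
Proof. by move=> n0; rewrite -[n%:R]subr0; exact: fps2_natBr_unit. Qed.

Lemma fps2_natBu_unit n : (0 < n)%N -> (n%:R - u) \is a GRing.unit.
Proof. by move=> n0; exact: fps2_natBr_unit. Qed.

Lemma fps2_natBv_unit n : (0 < n)%N -> (n%:R - v) \is a GRing.unit.
Proof. by move=> n0; exact: fps2_natBr_unit. Qed.

(* The expansion of 1 / (m_j (m_j - u)). *)
Definition geom_u (j : nat) : fps2 R := fpsC (Fps (fun p => x j ^+ p.+2)).

(* The expansion of \prod_(i < n) m_i / (m_i - v). *)
Definition prod_v (n : nat) : fps2 R := Fps (fun q => fpsC (hsym x n q)).

Lemma coef_geom_u_prod_v j p q :
  fps2_coef (geom_u j * prod_v j.+1) p q = tstar_summand N a R p.+2 q j.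
Proof. by rewrite /fps2_coef fps_coefCM mulrC fps_coefCM mulrC. Qed.

Lemma natr_aprogV j : (m j)%:R * x j = 1.
Proof. by rewrite mulfV // pnatr_eq0 -lt0n aprog_gt0. Qed.

(** Justifies the closed form announced for [geom_u]: multiplying by [m j - u] makes consecutive
    coefficients of the geometric series cancel. *)
Lemma geom_uM j : (m j)%:R * ((m j)%:R - u) * geom_u j = 1.
Proof.
apply: fps2P => p q; rewrite -mulrA fps2_coef_natM mulrBl fps2_coefD fps2_coefN.
rewrite fps2_coef_natM fps2_coefUM fps2_coef1 /fps2_coef /=.
case: q => [|q] /=; last first.
  by rewrite andbF; case: p => *; rewrite /= ?mulr0 subr0 mulr0.
case: p => [|p] /=.
  by rewrite subr0 expr2 mulrA mulrACA !natr_aprogV mulr1.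
by rewrite exprS mulrA natr_aprogV mul1r subrr mulr0.
Qed.

(** This is [hsymS] read on generating functions in v, with [m n * x n = 1]; with [prod_v0] it
    determines [prod_v] as the product of the m_i / (m_i - v). *)
Lemma prod_vS n : ((m n)%:R - v) * prod_v n.+1 = (m n)%:R * prod_v n.
Proof.
apply: fps2P => p q; rewrite mulrBl fps2_coefD fps2_coefN !fps2_coef_natM.
rewrite fps2_coefVM /fps2_coef /=; case: p => [|p] /=; last first.
  by case: q => *; rewrite mulr0 subr0.
case: q => [|q]; first by rewrite !hsym0 subr0.
by rewrite hsymS mulrDr mulrA natr_aprogV mul1r addrK.
Qed.

Lemma prod_v0 : prod_v 0 = 1.
Proof. by apply: fps2P => -[|p] [|q]. Qed.

(** The same first-order recurrence in [j] as in [hyp3F2_term_ratio]. *)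
Lemma geom_u_prod_vS j :
  geom_u j.+1 * prod_v j.+2 *
    (((m j.+1)%:R - u) * ((m j.+1)%:R - v)) =
  geom_u j * prod_v j.+1 * ((m j)%:R * ((m j)%:R - u)).
Proof.
transitivity (((m j.+1)%:R * ((m j.+1)%:R - u) * geom_u j.+1) * prod_v j.+1).
  by rewrite mulrACA [prod_v _ * _]mulrC prod_vS; ring.
by rewrite geom_uM -[X in X * _](geom_uM j); ring.
Qed.

(** Both sides agree at [j = 0] and satisfy the same recurrence, whose leading factor is a unit and
    can be cancelled. *)
Lemma hyp3F2_term_tstar j :
  let A : fps2 R := a%:R in
  let M : fps2 R := N%:R in
  1 / ((A - u) * (A - v)) *
    hyp3F2_term (A / M) ((A - u) / M) 1 ((A + M - u) / M) ((A + M - v) / M) 1 j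
  = geom_u j * prod_v j.+1.
Proof.
move=> A M.
have m0 i : (0 < m i)%N := aprog_gt0 ha i.
have mE i : A + M * i%:R = (m i)%:R by rewrite -natrM -natrD.
have Uu i : (m i)%:R - u \is a GRing.unit := fps2_natBu_unit (m0 i).
have Uv i : (m i)%:R - v \is a GRing.unit := fps2_natBv_unit (m0 i).
have AE : A = (m 0)%:R by rewrite /aprog muln0 addn0.
elim: j => [|j IH].
  rewrite hyp3F2_term0 mulr1 AE; apply: (mulIr (Uu 0)); apply: (mulIr (Uv 0)).
  rewrite -mulrA divrK ?unitrM ?Uu ?Uv // -[LHS](geom_uM 0).
  transitivity ((m 0)%:R * prod_v 0 * (((m 0)%:R - u) * geom_u 0)).
    by rewrite prod_v0; ring.
  by rewrite -prod_vS; ring.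
have ratio := @hyp3F2_term_ratio (fps2 R) A M u v j (fps2_nat_unit hN).
have Ud : ((m j.+1)%:R - u) * ((m j.+1)%:R - v) \is a GRing.unit.
  by rewrite unitrM Uu Uv.
apply: (mulIr Ud); rewrite geom_u_prod_vS -IH -[LHS]mulrA -[RHS]mulrA.
congr (_ * _); rewrite -!mE; apply: ratio => [i|i|n n0].
- by rewrite mE.
- by rewrite mE.
- exact: fps2_nat_unit.
Qed.

(** The exponents [k - n - 1 = p] and [n - 1 = q] leave only the pair [n = q.+1],
    [k = (p + q).+2]. *)
Lemma tstar_gen_term_coef k p q : fps2_coef (tstar_gen_term R N a k) p q =
  if k == (p + q).+2 then tstar R N a (p.+2 :: nseq q 1%N) else 0.
Proof.
rewrite /tstar_gen_term fps2_coef_sum big_nat.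
under eq_bigr => n hn.
  rewrite fps2_coefUV (_ : (p == _) && (q == _) =
    (n == q.+1) && (k == (p + q).+2)); last by lia.
  over.
have [kE|_] /= := eqVneq k (p + q).+2; last first.
  by rewrite big1 // => n _; rewrite andbF.
rewrite -big_nat (bigD1_seq q.+1) /= ?mem_index_iota ?iota_uniq //; last by lia.
rewrite eqxx big1 => [|n /negPf -> //]; rewrite addr0 kE.
by congr (tstar _ _ _ (_ :: nseq _ _)); lia.
Qed.

Lemma tstar_gen_partial_cvg p q : fps2_partial (tstar_gen_term R N a) p q @ \oo
  --> tstar R N a (p.+2 :: nseq q 1%N).
Proof.
(* A partial sum of length [n] contains the one contributing index [(p + q).+2] as soon as [n] is at
   least [(p + q).+3]; from there on it is constant. *)
apply: cvg_near_cst; exists (p + q).+3 => //= n /= hn.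
rewrite fps2_partialE (bigD1_seq (p + q).+2) ?iota_uniq ?mem_index_iota //=.
rewrite tstar_gen_term_coef eqxx big1 ?addr0 // => k /negPf kn.
by rewrite tstar_gen_term_coef kn.
Qed.

Lemma fps2_partial_geom_u_prod_v p q :
  fps2_partial (fun j => geom_u j * prod_v j.+1) p q =
  fun n => \sum_(0 <= j < n) tstar_summand N a R p.+2 q j.
Proof.
apply: funext => n; rewrite fps2_partialE.
by apply: eq_bigr => j _; exact: coef_geom_u_prod_v.
Qed.

End GeneratingTerms.

(** * The generating function identity *)

Theorem corollary2p6 (R : realType) (N a : nat)
    (hN : (0 < N)%N) (ha : (1 <= a <= N)%N) :
  let u := fpsU R in
  let v := fpsV R in
  let A : fps2 R := a%:R in
  let M : fps2 R := N%:R in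
  [/\ forall k n : nat, (1 <= n)%N -> (n + 1 <= k)%N ->
        tstar_summable R N a ((k - n + 1)%N :: nseq (n - 1) 1%N),
      fps2_summable (tstar_gen_term R N a),
      fps2_summable (hyp3F2_term (A / M) ((A - u) / M) 1
                       ((A + M - u) / M) ((A + M - v) / M) 1)
    & fps2_sum (tstar_gen_term R N a) =
        1 / ((A - u) * (A - v)) *
        hyp3F2 (A / M) ((A - u) / M) 1 ((A + M - u) / M) ((A + M - v) / M) 1].
Proof.
move=> u v A M; have a0 : (0 < a)%N by case/andP: ha.
set T := hyp3F2_term _ _ _ _ _ _.
have U0 : (A - u) * (A - v) \is a GRing.unit.
  by rewrite unitrM fps2_natBu_unit // fps2_natBv_unit.
pose G j : fps2 R := geom_u R N a j * prod_v R N a j.+1.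
have GE : (fun j => 1 / ((A - u) * (A - v)) * T j) = G.
  by apply: funext => j; exact: hyp3F2_term_tstar.
have GS : fps2_summable G.
  move=> p q; rewrite fps2_partial_geom_u_prod_v.
  exact: is_cvg_tstar_summand.
have TS : fps2_summable T.
  (* Summability of the hypergeometric terms is pulled back from that of [G], of which they are a
     fixed multiple. *)
  have -> : T = fun j => (A - u) * (A - v) * G j.
    by apply: funext => j; rewrite -GE mulrA div1r divrr // mul1r.
  exact: fps2_summable_mul.
split=> //.
- by move=> k n n1 nk; apply: tstar_summable_cons => //; lia.
- by move=> p q; apply: cvgP; exact: tstar_gen_partial_cvg.
(* On both sides the coefficient of u^p v^q is the star value with exponents p + 2, 1, ..., 1 ([q]
   ones). *)
- rewrite /hyp3F2 -/T -fps2_sum_mul // GE; apply: fps2P => p q.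
  transitivity (tstar R N a (p.+2 :: nseq q 1%N)).
    by apply: cvg_lim => //; exact: tstar_gen_partial_cvg.
  by rewrite tstar_consE // -fps2_partial_geom_u_prod_v.
Qed.
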